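(* Let $Q$ be a finite poset that satisfies the GPC. Then for every finite poset $P$ and every $i\in P$, the poset $P\circ_i Q$ satisfies the GPC.
   Context: For a finite poset $P$, a linearization of $P$ is a linear order on the underlying set of $P$ that extends $\leq_P$. Let $L(P)$ be the set of linearizations of $P$ and $e(P)=|L(P)|$. Lexicographic sum: given posets $P=(\{p_1,\dots,p_n\},<_P)$ and $(Q_1,<_{Q_1}),\dots,(Q_n,<_{Q_n})$, the lexicographic sum $P(Q_1,\dots,Q_n)$ is the disjoint union $\bigsqcup_j Q_j$ with the order in which $x<y$ iff either $x,y\in Q_j$ for some $j$ and $x<_{Q_j}y$, or $x\in Q_k$, $y\in Q_j$ and $p_k<_P p_j$. For $i\in P$, $P\circ_i Q$ denotes the lexicographic sum in which the poset placed at the point $i$ is $Q$ and the posets placed at all other points of $P$ are one-point posets. Satisfying the GPC (Gold Partition Conjecture): a comparison is a choice of two distinct elements $x,y$ of the poset; its result is either $x<y$ or $y<x$. A finite poset $P$ satisfies the GPC if there are two consecutive comparisons of elements of $P$ (a first comparison, followed by a second comparison whose choice may depend on the result of the first) such that, regardless of their results, $t_0>t_1+t_2$, where $t_0=e(P)$, $t_1$ is the number of linearizations of $P$ consistent with the result of the first comparison, and $t_2$ is the number of linearizations of $P$ consistent with the results of both comparisons. In particular, a chain (linear order) does not satisfy the GPC in this sense. *)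

(* Defs.v *)
From HB Require Import structures.
From mathcomp Require Import all_boot all_order.

Set Implicit Arguments.
Unset Strict Implicit.
Unset Printing Implicit Defensive.

Import Order.TTheory.
Local Open Scope order_scope.

(* Linear orders are represented by their graphs, as sets of pairs (x, y)
   standing for "x is at most y", so that they can be counted. *)
Definition rel_of (T : finType) (L : {set T * T}) : rel T :=
  fun x y => (x, y) \in L.

Definition is_linear_order (T : finType) (L : {set T * T}) : bool :=
  [&& [forall x, rel_of L x x],
      [forall x, forall y, rel_of L x y && rel_of L y x ==> (x == y)],
      [forall x, forall y, forall z,
         rel_of L x y && rel_of L y z ==> rel_of L x z]
    & [forall x, forall y, rel_of L x y || rel_of L y x]].

Lemma is_linear_orderP (T : finType) (L : {set T * T}) :
  reflect [/\ reflexive (rel_of L), antisymmetric (rel_of L),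
              transitive (rel_of L) & total (rel_of L)]
          (is_linear_order L).
Proof.
apply: (iffP and4P) => -[Hr Ha Ht Hl]; split.
- by move=> x; apply: (forallP Hr).
- by move=> x y xy; apply/eqP/(implyP (forallP (forallP Ha x) y)).
- move=> y x z xy yz.
  by apply: (implyP (forallP (forallP (forallP Ht x) y) z)); rewrite xy.
- by move=> x y; apply: (forallP (forallP Hl x) y).
- by apply/forallP => x; apply: Hr.
- by apply/forallP => x; apply/forallP => y; apply/implyP => /Ha ->.
- do 3![apply/forallP => ?]; apply/implyP => /andP[]; exact: Ht.
- by do 2![apply/forallP => ?]; apply: Hl.
Qed.

Definition linearizations (d : Order.disp_t) (P : finPOrderType d)
    : {set {set P * P}} :=
  [set L | is_linear_order L &&
           [forall x : P, forall y : P, (x <= y) ==> rel_of L x y]].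

Definition nb_linearizations (d : Order.disp_t) (P : finPOrderType d) : nat :=
  #|linearizations P|.

(* A comparison is a pair c of distinct elements.  Its result is the ordered
   pair (x, y) for "x < y": either c itself or c with its components swapped. *)
Definition result (T : Type) (c : T * T) (b : bool) : T * T :=
  if b then c else (c.2, c.1).

Definition consistent (T : finType) (L : {set T * T}) (r : T * T) : bool :=
  (r.1 != r.2) && rel_of L r.1 r.2.

Definition satisfies_GPC (d : Order.disp_t) (P : finPOrderType d) : Prop :=
  exists (c1 : P * P) (c2 : bool -> P * P),
    [/\ c1.1 != c1.2, forall b1, (c2 b1).1 != (c2 b1).2
      & forall b1 b2 : bool,
          let t0 := nb_linearizations P in
          let t1 := #|[set L in linearizations P |
                        consistent L (result c1 b1)]| in
          let t2 := #|[set L in linearizations P |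
                        consistent L (result c1 b1) &
                        consistent L (result (c2 b1) b2)]| in
          (t1 + t2 < t0)%N].

(* The library's lexicographic order on sigma types, for a base that need not
   be totally ordered, is the lexicographic sum; see lexsum_ltP. *)
Definition lexsum (d d' : Order.disp_t) (P : finPOrderType d)
    (Q : P -> finPOrderType d') : finPOrderType d' :=
  {p : P & Q p}.

Lemma lexsum_ltP (d d' : Order.disp_t) (P : finPOrderType d)
    (Q : P -> finPOrderType d') (x y : lexsum Q) :
  x < y <->
  (exists (j : P) (a b : Q j),
     [/\ x = Tagged (fun p => Q p) a, y = Tagged (fun p => Q p) b & a < b])
  \/ tag x < tag y.
Proof.
rewrite ltEsig; split.
  case: x y => [k a] [j b] /=.
  case: (comparableP k j) => //= [lt_kj _|eq_kj]; first by right.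
  by subst j; rewrite tagged_asE => lt_ab; left; exists k, a, b.
case=> [[m [a [b [-> -> lt_ab]]]]|lt_xy]; first by rewrite /= lexx tagged_asE.
by rewrite (ltW lt_xy) lt_geF.
Qed.

(* The one-point poset, for an arbitrary display d, so that it can occur in
   the same family as a given poset with display d. *)
Definition point (d : Order.disp_t) : Type := unit.
HB.instance Definition _ d := Finite.on (point d).
Fact point_lt_def d (x y : point d) : false = (y != x) && true.
Proof. by case: x y => -[]. Qed.
Fact point_refl d : reflexive (fun _ _ : point d => true).
Proof. by []. Qed.
Fact point_anti d : antisymmetric (fun _ _ : point d => true).
Proof. by case=> -[]. Qed.
Fact point_trans d : transitive (fun _ _ : point d => true).
Proof. by []. Qed.
HB.instance Definition _ d := Order.isPOrder.Build d (point d)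
  (@point_lt_def d) (@point_refl d) (@point_anti d) (@point_trans d).

Definition lexsum_at (d d' : Order.disp_t) (P : finPOrderType d) (i : P)
    (Q : finPOrderType d') : finPOrderType d' :=
  lexsum (fun j : P => if j == i then Q else point d').

(* Main.v *)
(* Permuting the elements of Q according to the order isomorphism between two
   linearizations M and M' of Q, and fixing the other points, maps the
   linearizations of P o_i Q that restrict to M onto those that restrict to M',
   because the points of Q compare in the same way to every point outside Q.
   Hence restriction to Q is N-to-1 for a constant N > 0, and a pair of
   comparisons in Q, made inside P o_i Q, multiplies t_0, t_1 and t_2 by N. *)
Require Import Defs.
From mathcomp Require Import all_boot all_order.

Set Implicit Arguments.
Unset Strict Implicit.
Unset Printing Implicit Defensive.

Import Order.TTheory.
Local Open Scope order_scope.

(** Sorting the enumeration of [T] by [M] gives [s]; the position in [s] is then the rank for [M],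
    with antisymmetry excluding ties. *)
Lemma linear_order_index (T : finType) (M : {set T * T}) :
  is_linear_order M ->
  exists2 s : seq T, perm_eq s (enum T)
    & forall x y, rel_of M x y = (index x s <= index y s)%N.
Proof.
case/is_linear_orderP=> Mr Ma Mt Ml; exists (sort (rel_of M) (enum T)).
  by rewrite perm_sort.
set s := sort _ _.
have sM : sorted (rel_of M) s by apply: sort_sorted.
have ms x : x \in s by rewrite mem_sort mem_enum.
have le_index x y : (index x s <= index y s)%N -> rel_of M x y.
  exact: (sorted_leq_index Mt Mr sM) (ms x) (ms y).
move=> x y; apply/idP/idP=> [Mxy|/le_index //].
case/orP: (leq_total (index x s) (index y s)) => // /le_index Myx.
by rewrite (Ma x y) ?leqnn // Mxy.
Qed.

(** Each element goes to the element that has the same rank in the other order. *)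
Lemma linear_order_iso (T : finType) (M M' : {set T * T}) :
  is_linear_order M -> is_linear_order M' ->
  exists2 s : T -> T, injective s
    & forall x y, rel_of M x y = rel_of M' (s x) (s y).
Proof.
case/linear_order_index=> u pu Mu /linear_order_index[v pv Mv].
have mu x : x \in u by rewrite (perm_mem pu) mem_enum.
have uv : size u = size v by rewrite (perm_size pu) (perm_size pv).
have v_uniq : uniq v by rewrite (perm_uniq pv) enum_uniq.
have iK x : index (nth x v (index x u)) v = index x u.
  by rewrite index_uniq // -uv index_mem.
(* The default of [nth] is never reached, since [u] and [v] have equal size. *)
exists (fun x => nth x v (index x u)) => [x y /(congr1 (index^~ v))|x y].
  by rewrite !iK; apply: index_inj.
by rewrite Mu Mv !iK.
Qed.

Lemma linearizationsP (d : Order.disp_t) (P : finPOrderType d)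
    (L : {set P * P}) :
  reflect (is_linear_order L /\ forall x y : P, x <= y -> rel_of L x y)
          (L \in linearizations P).
Proof.
rewrite inE; apply: (iffP andP) => -[Llin Lext]; split=> //.
  by move=> x y; apply: (implyP (forallP (forallP Lext x) y)).
by apply/forallP=> x; apply/forallP=> y; apply/implyP/Lext.
Qed.

Lemma nb_linearizations_gt0 (d : Order.disp_t) (P : finPOrderType d) :
  (0 < nb_linearizations P)%N.
Proof.
pose down (x : P) := #|[set y : P | y <= x]|.
have down_lt x y : x < y -> (down x < down y)%N.
  move=> ltxy; apply/proper_card/properP; split.
    by apply/subsetP=> z; rewrite !inE => /le_trans; apply; apply: ltW.
  by exists y; rewrite !inE ?lexx // lt_geF.
(* The key encodes the pair ([down x], [enum_rank x]) in base [#|P|]: it respects the order of [P]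
   through the leading digit and breaks ties through the last one. *)
pose key x := (down x * #|P| + enum_rank x)%N.
have key_mod x : key x %% #|P| = enum_rank x.
  by rewrite /key modnMDl modn_small.
have key_inj : injective key.
  move=> x y /(congr1 (modn^~ #|P|)); rewrite !key_mod => /val_inj.
  exact: enum_rank_inj.
apply/card_gt0P; exists [set p | (key p.1 <= key p.2)%N].
apply/linearizationsP; split=> [|x y].
  apply/is_linear_orderP; split=> [x|x y|y x z|x y]; rewrite /rel_of !inE //=.
  - by rewrite -eqn_leq => /eqP/key_inj.
  - exact: leq_trans.
  - exact: leq_total.
rewrite le_eqVlt /rel_of inE => /orP[/eqP -> //|/down_lt lt_down] /=.
apply: leq_trans (leq_addr _ _); apply: leq_trans (leq_mul lt_down (leqnn _)).
by rewrite mulSn [leqRHS]addnC /key leq_add2l ltnW.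
Qed.

Section AutonomousEmbedding.

Variables (dR dQ : Order.disp_t) (R : finPOrderType dR) (Q : finPOrderType dQ).
Variable f : Q -> R.
Hypothesis f_le : forall a b, (f a <= f b) = (a <= b).
(** With [f_le], the next two hypotheses make the image of [f] an autonomous copy of [Q] in [R];
    they are all that is used of the lexicographic sum. *)
Hypothesis f_below :
  forall x, x \notin codom f -> forall a b, (f a <= x) = (f b <= x).
Hypothesis f_above :
  forall x, x \notin codom f -> forall a b, (x <= f a) = (x <= f b).

Let f_inj : injective f.
Proof. by move=> a b ab; apply: le_anti; rewrite -!f_le ab lexx. Qed.

Definition restriction (L : {set R * R}) : {set Q * Q} :=
  [set p | (f p.1, f p.2) \in L].

Lemma rel_of_restriction L a b :
  rel_of (restriction L) a b = rel_of L (f a) (f b).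
Proof. by rewrite /rel_of inE. Qed.

Lemma restriction_linearization L :
  L \in linearizations R -> restriction L \in linearizations Q.
Proof.
case/linearizationsP=> /is_linear_orderP[Lr La Lt Ll] Lext.
apply/linearizationsP; split=> [|a b]; last first.
  by rewrite rel_of_restriction -f_le => /Lext.
apply/is_linear_orderP; split=> [a|a b|b a c|a b]; rewrite !rel_of_restriction.
- exact: Lr.
- by move/La/f_inj.
- exact: Lt.
- exact: Ll.
Qed.

Lemma consistent_restriction L a b :
  consistent (restriction L) (a, b) = consistent L (f a, f b).
Proof. by rewrite /consistent /= rel_of_restriction (inj_eq f_inj). Qed.

Definition fiber M := [set L in linearizations R | restriction L == M].

Definition extend (s : Q -> Q) (x : R) : R :=
  if [pick a | f a == x] is Some a then f (s a) else x.

Lemma extend_f s a : extend s (f a) = f (s a).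
Proof.
by rewrite /extend; case: pickP => [b /eqP/f_inj ->|/(_ a)/eqP].
Qed.

Lemma extend_out s x : x \notin codom f -> extend s x = x.
Proof.
rewrite /extend; case: pickP => [a /eqP <-|//].
by rewrite codom_f.
Qed.

Lemma extend_inj s : injective s -> injective (extend s).
Proof.
move=> s_inj x y.
have [/codomP[a ->]|xN] := boolP (x \in codom f);
  have [/codomP[b ->]|yN] := boolP (y \in codom f);
  rewrite ?extend_f ?(extend_out s xN) ?(extend_out s yN) //.
- by move=> /f_inj/s_inj ->.
- by move=> e; rewrite -e codom_f in yN.
- by move=> e; rewrite e codom_f in xN.
Qed.

(** Pulling back along the extension of the isomorphism from [M] to [M'] injects [fiber M'] into
    [fiber M]. Exchanging [M] and [M'] then gives equality. *)
Lemma card_fiber_le M M' : M \in linearizations Q -> M' \in linearizations Q ->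
  (#|fiber M'| <= #|fiber M|)%N.
Proof.
case/linearizationsP=> Mlin Mext /linearizationsP[M'lin _].
have [s s_inj MM'] := linear_order_iso Mlin M'lin.
have S_inj := extend_inj s_inj; set S := extend s in S_inj.
pose pull (L : {set R * R}) := [set p | (S p.1, S p.2) \in L].
have pullE L x y : rel_of (pull L) x y = rel_of L (S x) (S y).
  by rewrite /rel_of inE.
have pull_inj : injective pull.
  move=> L L' eqL; apply/setP=> -[x y].
  (* An injective self-map of a finite type is bijective, so [L] can be read back from [pull L]. *)
  have [S' _ S'K] := injF_bij S_inj.
  by have := pullE L (S' x) (S' y); rewrite eqL pullE /rel_of !S'K.
rewrite -(card_imset _ pull_inj); apply/subset_leq_card/subsetP=> X.
case/imsetP=> L; rewrite inE => /andP[/linearizationsP[Llin Lext] /eqP LM'] ->.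
have [Lr La Lt Ll] := is_linear_orderP _ Llin.
rewrite inE; apply/andP; split; last first.
  apply/eqP/setP=> -[a b].
  change (rel_of (restriction (pull L)) a b = rel_of M a b).
  by rewrite rel_of_restriction pullE /S !extend_f -rel_of_restriction LM' MM'.
apply/linearizationsP; split=> [|x y lexy].
  apply/is_linear_orderP; split=> [x|x y|y x z|x y]; rewrite !pullE.
  - exact: Lr.
  - by move/La/S_inj.
  - exact: Lt.
  - exact: Ll.
rewrite pullE; move: lexy; rewrite /S.
(* Inside the image, [s] need not preserve the order of [Q], so the argument passes through [M],
   which extends it. In the mixed cases, autonomy allows [f a] to be replaced by [f (s a)]. *)
have [/codomP[a ->]|xN] := boolP (x \in codom f);
  have [/codomP[b ->]|yN] := boolP (y \in codom f);
  rewrite ?extend_f ?(extend_out s xN) ?(extend_out s yN) => lexy.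
- by rewrite -rel_of_restriction LM' -MM'; apply: Mext; rewrite -f_le.
- by apply: Lext; rewrite (f_below yN _ a).
- by apply: Lext; rewrite (f_above xN _ b).
- exact: Lext.
Qed.

(** The linearizations of [R] are grouped by restriction, and all fibers have the same size [N].
    Quantifying over [p] after [N] lets one constant serve for all three counts. *)
Lemma card_restriction : exists2 N, (0 < N)%N
  & forall p : pred {set Q * Q},
    #|[set L in linearizations R | p (restriction L)]| =
      (#|[set M in linearizations Q | p M]| * N)%N.
Proof.
have /card_gt0P[L0 linL0] := nb_linearizations_gt0 R.
have linM0 := restriction_linearization linL0.
exists #|fiber (restriction L0)| => [|p].
  by apply/card_gt0P; exists L0; rewrite inE linL0 eqxx.
rewrite -sum1_card -sum_nat_const.
rewrite (partition_big restriction (mem [set M in linearizations Q | p M])).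
  apply: eq_bigr => M; rewrite /= inE => /andP[linM pM].
  transitivity #|fiber M|.
    rewrite -sum1_card; apply: eq_bigl => L; rewrite !inE.
    by case: eqP => [->|]; rewrite ?pM ?andbT ?andbF.
  by apply/eqP; rewrite eqn_leq !card_fiber_le.
move=> L; rewrite !inE => /andP[linL ->]; rewrite andbT.
by have := @restriction_linearization L; rewrite !inE => ->.
Qed.

Lemma satisfies_GPC_embedding : satisfies_GPC Q -> satisfies_GPC R.
Proof.
case=> c1 [c2 [c1N c2N c12]]; pose fp (c : Q * Q) := (f c.1, f c.2).
exists (fp c1), (fp \o c2); split=> [|b|b1 b2 /=]; rewrite ?(inj_eq f_inj) //.
have fp_result c b L :
    consistent L (result (fp c) b) = consistent (restriction L) (result c b).
  by case: b; rewrite /= ?consistent_restriction // [c in RHS]surjective_pairing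
    consistent_restriction.
have [N N_gt0 cardN] := card_restriction.
have := c12 b1 b2; rewrite /= -(ltn_pmul2r N_gt0) mulnDl.
have -> : (nb_linearizations Q * N = nb_linearizations R)%N.
  transitivity #|[set L in linearizations R | predT (restriction L)]|.
    rewrite cardN; congr (_ * _)%N.
    by apply: eq_card => M; rewrite [RHS]inE andbT.
  by apply: eq_card => L; rewrite [LHS]inE andbT.
rewrite -(cardN (fun M => consistent M _)).
rewrite -(cardN (fun M => consistent M _ && consistent M _)).
congr (_ + _ < _)%N; apply: eq_card => L.
  by rewrite !inE -fp_result.
by rewrite !inE -!fp_result.
Qed.

End AutonomousEmbedding.

(** The summand at [i] is a conditional on [i == i], which does not reduce to [Q]; abstracting the
    boolean allows a case analysis without casts. *)
Lemma if_finPOrder_iso (d : Order.disp_t) (b : bool) (Q Q' : finPOrderType d) :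
  b -> exists2 g : Q -> (if b then Q else Q'), (forall y, exists x, y = g x)
    & forall x y, (g x <= g y) = (x <= y).
Proof. by case: b => // _; exists id => // y; exists y. Qed.

Theorem lemma2p5 (dQ : Order.disp_t) (Q : finPOrderType dQ)
    (hQ : satisfies_GPC Q) (dP : Order.disp_t) (P : finPOrderType dP) (i : P) :
  satisfies_GPC (lexsum_at i Q).
Proof.
have [g g_onto g_le] :=
  @if_finPOrder_iso _ (i == i) Q (point dQ : finPOrderType dQ) (eqxx i).
pose F j : finPOrderType dQ := if j == i then Q else point dQ.
pose f a : lexsum_at i Q := Tagged F (g a : F i).
have outN (x : lexsum_at i Q) : x \notin codom f -> tag x != i.
  apply: contraNneq; case: x => j y /= ji; subst j.
  by have [a ->] := g_onto y; apply: (codom_f f).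
(* A point outside the copy of [Q] has a tag other than [i], so its comparison with any [f a]
   depends on the tags alone. *)
apply: (satisfies_GPC_embedding (f := f)) hQ => [a b|x /outN xi a b|x /outN xi a b].
- by rewrite leEsig /= lexx tagged_asE g_le.
- rewrite !leEsig /=; case: (boolP (i <= tag x)) => //= le_ix.
  by rewrite lt_geF // lt_neqAle eq_sym xi.
- rewrite !leEsig /=; case: (boolP (tag x <= i)) => //= le_xi.
  by rewrite lt_geF // lt_neqAle xi.
Qed.
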